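(* Let $\mathcal{X}$ be a linear space over $\mathbb{K}$ ($\mathbb{K}=\mathbb{R}$ or $\mathbb{C}$). Let $\mathbf{Mp}^2=\{PQ:P,Q\text{ multivalued projections in }\mathcal{X}\}$ and let $\mathbf{Q}$ be the set of projections in $\mathcal{X}$. Then $$\mathbf{Mp}^2=\{P_0Q_0\,\hat{\dotplus}\,(\{0\}\times\mathcal{S}): P_0,Q_0\in\mathbf{Q},\ \mathcal{S}\subseteq\ker P_0\},$$ where $\mathcal{S}$ ranges over linear subspaces of $\mathcal{X}$.
   Context: A linear relation in $\mathcal{X}$ is a linear subspace $T$ of $\mathcal{X}\times\mathcal{X}$. Write $\operatorname{dom}T=\{x:\exists y,\ (x,y)\in T\}$, $\operatorname{ran}T=\{y:\exists x,\ (x,y)\in T\}$, $\ker T=\{x:(x,0)\in T\}$, $\operatorname{mul}T=\{y:(0,y)\in T\}$. The product is $ST=\{(x,z): (x,y)\in T \text{ and } (y,z)\in S\text{ for some }y\}$. $T\,\hat{\dotplus}\,S$ denotes the sum of $T$ and $S$ as subspaces of $\mathcal{X}\times\mathcal{X}$ when $T\cap S=\{(0,0)\}$. A multivalued projection in $\mathcal{X}$ is a linear relation $P$ in $\mathcal{X}$ with $P^2=P$ and $\operatorname{ran}P\subseteq\operatorname{dom}P$; a projection is a multivalued projection $P$ with $\operatorname{mul}P=\{0\}$ (its domain need not be all of $\mathcal{X}$). *)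

(* Defs.v *)
From HB Require Import structures.
From mathcomp Require Import all_boot all_order all_algebra.
From mathcomp Require Import boolp classical_sets reals.
From mathcomp Require Import complex.

Set Implicit Arguments.
Unset Strict Implicit.
Unset Printing Implicit Defensive.

Import GRing.Theory.
Local Open Scope ring_scope.
Local Open Scope classical_set_scope.

Variant RorC := RealScalars | ComplexScalars.

Definition scalars (R : realType) (k : RorC) : fieldType :=
  match k with RealScalars => R | ComplexScalars => R[i] end.

Definition subspace (K : fieldType) (V : lmodType K) (S : set V) : Prop :=
  submod_closed (mem S).

(* For a relation T in X, the library already provides dom T as T.`1, ran T as
   T.`2, and the product ST as (S \; T)%relation, with T applied first. *)
Section LinearRelations.
Context (K : fieldType) (X : lmodType K).
Implicit Types (T P : set (X * X)).

Definition ker T : set X := [set x | T (x, 0)].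

Definition mul T : set X := [set y | T (0, y)].

Definition multivalued_projection P : Prop :=
  [/\ subspace P, (P \; P)%relation = P & P.`2 `<=` P.`1].

Definition projection P : Prop :=
  multivalued_projection P /\ mul P = [set 0].

End LinearRelations.

(* The sum of two subspaces is direct only when they meet trivially, so the
   direct sum is a partial operation, given here by its graph. *)
Definition is_direct_sum (K : fieldType) (V : lmodType K) (W A B : set V) : Prop :=
  A `&` B = [set 0] /\ W = [set a + b | a in A & b in B].

Definition Mp2 (K : fieldType) (X : lmodType K) : set (set (X * X)) :=
  [set (P \; Q)%relation | P in @multivalued_projection K X
                         & Q in @multivalued_projection K X].
Arguments Mp2 {K} X.

(* Main.v *)
Require Import Defs.
From HB Require Import structures.
From mathcomp Require Import all_boot all_order all_algebra.
From mathcomp Require Import boolp classical_sets reals.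

Set Implicit Arguments.
Unset Strict Implicit.
Unset Printing Implicit Defensive.

Import GRing.Theory.
Local Open Scope ring_scope.
Local Open Scope classical_set_scope.

(** A multivalued projection is determined by its range M and its kernel N,
    which may be any two subspaces: it consists of the pairs (x, y) with y in M
    and x - y in N, and its multivalued part is M `&` N
    ([multivalued_projectionE], [mproj_multivalued_projection], [mul_mproj]).
    So (x, y) belongs to the product of the multivalued projections with ranges
    M, E and kernels N, F, the second applied first, exactly when there is an e
    with x - e in F, e in E, e - y in N and y in M.

    Such a product can be rewritten with genuine projections in two moves. If
    E `&` F lies in N, then e only matters modulo E `&` F, so E can be replaced
    by a complement of E `&` F in E, which meets F trivially
    ([mproj_comp_shrink]). The condition E `&` F `<=` N is no restriction,
    because adding E `&` F to N does not change the product: the summand can be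
    moved into F ([mproj_comp_enlarge]). If S is contained in N, then a summand
    of M in S affects only y, and e - y in N does not see it; hence enlarging M
    by S amounts to adding {0} x S to the product ([mproj_comp_addl]). Taking
    S = M `&` N, with N already enlarged, and replacing M by a complement of S
    in M leaves a left factor that is a projection; the sum is direct because a
    product of projections is single-valued ([mul_comp_projection]). The last identity, read in the other direction, turns P0 Q0 plus
    {0} x S into a product of multivalued projections. Complements are supplied
    by Zorn's lemma ([subspace_complement]). *)

Section Subspaces.
Context (K : fieldType) (V : lmodType K).
Implicit Types A B C S : set V.

Lemma subspaceP S :
  subspace S <-> S 0 /\ forall a u v, S u -> S v -> S (a *: u + v).
Proof.
split=> -[S0 Slin]; split; first by rewrite inE in S0.
- by move=> a u v Su Sv; have := Slin a u v; rewrite !inE; apply.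
- by rewrite inE.
- by move=> a u v; rewrite !inE; apply: Slin.
Qed.

Lemma subspace0 S : subspace S -> S 0.
Proof. by case/subspaceP. Qed.

Lemma subspaceZD S a u v : subspace S -> S u -> S v -> S (a *: u + v).
Proof. by move=> /subspaceP[_]; apply. Qed.

Lemma subspaceZ S a u : subspace S -> S u -> S (a *: u).
Proof.
by move=> sS Su; rewrite -[_ *: _]addr0; apply: subspaceZD => //; apply: subspace0.
Qed.

Lemma subspaceD S u v : subspace S -> S u -> S v -> S (u + v).
Proof. by move=> sS Su Sv; rewrite -[u]scale1r; apply: subspaceZD. Qed.

Lemma subspaceN S u : subspace S -> S u -> S (- u).
Proof.
by move=> sS Su; rewrite -scaleN1r; apply: subspaceZ.
Qed.

Lemma subspaceB S u v : subspace S -> S u -> S v -> S (u - v).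
Proof. by move=> sS Su Sv; apply: subspaceD => //; apply: subspaceN. Qed.

Lemma subspaceI A B : subspace A -> subspace B -> subspace (A `&` B).
Proof.
move=> sA sB; apply/subspaceP; split; first by split; apply: subspace0.
by move=> a u v [Au Bu] [Av Bv]; split; apply: subspaceZD.
Qed.

Lemma subspace_sum A B : subspace A -> subspace B ->
  subspace [set a + b | a in A & b in B].
Proof.
move=> sA sB; apply/subspaceP; split.
  by exists 0; [exact: subspace0 | exists 0; [exact: subspace0 | rewrite addr0]].
move=> k _ _ [a Aa [b Bb <-]] [a' Aa' [b' Bb' <-]].
exists (k *: a + a'); first exact: subspaceZD.
exists (k *: b + b'); first exact: subspaceZD.
by rewrite scalerDr addrACA.
Qed.

(** A subspace C of B that is maximal among those meeting A trivially spans B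
    together with A: an element y of B outside A + C could be adjoined to C. *)
Lemma subspace_complement A B : subspace A -> subspace B -> A `<=` B ->
  exists C, subspace C /\ is_direct_sum B A C.
Proof.
move=> sA sB AB.
(* Membership of 0 is left out, so that the empty chain has a bound. *)
pose P C := [/\ forall k u v, C u -> C v -> C (k *: u + v), C `<=` B
  & forall x, A x -> C x -> x = 0].
have [C [[Clin CB AC0] maxC]] : exists C, P C /\ forall D, C `<` D -> ~ P D.
  apply: Zorn_bigcup => F FP totF; split.
  - move=> k u v [D FD Du] [D' FD' Dv].
    have [[Dlin _ _] [D'lin _ _]] := (FP _ FD, FP _ FD').
    have [DD'|D'D] := totF _ _ FD FD'.
      by exists D' => //; apply: D'lin => //; apply: DD'.
    by exists D => //; apply: Dlin => //; apply: D'D.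
  - by move=> x [D FD]; have [_ + _] := FP _ FD; apply.
  - by move=> x Ax [D FD]; have [_ _] := FP _ FD; apply.
have C0 : C 0.
  apply: contrapT => nC0; apply: (maxC [set 0]); last first.
    split=> [k u v -> ->|x ->|x _ //]; first by rewrite scaler0 addr0.
    exact: subspace0.
  split; last by move/(_ 0 erefl).
  by move=> x Cx; case: nC0; rewrite -(addNr x) -scaleN1r; apply: Clin.
have sC : subspace C by apply/subspaceP.
exists C; split=> //; split; apply/seteqP; split.
- by move=> x [Ax Cx]; apply: AC0.
- by move=> _ ->; split; apply: subspace0.
- move=> y By; apply: contrapT => nACy.
  (* D is C + K y. *)
  pose D := [set x | exists k c, C c /\ x = k *: y + c].
  apply: (maxC D).
    split; first by move=> c Cc; exists 0, c; rewrite scale0r add0r.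
    move=> DC; apply: nACy; exists 0; first exact: subspace0.
    exists y; last exact: add0r.
    by apply: DC; exists 1, 0; rewrite scale1r addr0.
  split.
  - move=> k _ _ [l [c [Cc ->]]] [l' [c' [Cc' ->]]].
    exists (k * l + l'), (k *: c + c'); split; first exact: Clin.
    by rewrite scalerDr scalerA scalerDl addrACA.
  - by move=> _ [k [c [Cc ->]]]; apply: subspaceZD => //; apply: CB.
  - move=> _ /[swap] -[k [c [Cc ->]]] Akyc.
    have [k0|k0] := eqVneq k 0.
      by move: Akyc; rewrite k0 scale0r add0r => /AC0; apply.
    case: nACy; exists (k^-1 *: (k *: y + c)).
      exact: subspaceZ.
    exists (- (k^-1 *: c)).
      by rewrite -scaleNr; apply: subspaceZ.
    by rewrite scalerDr addrK scalerA mulVf ?scale1r.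
- by move=> _ [a Aa [c Cc <-]]; apply: subspaceD => //; [apply: AB | apply: CB].
Qed.

Lemma direct_sum_subr W A B : subspace A -> is_direct_sum W A B -> B `<=` W.
Proof.
move=> sA [_ ->] b Bb; exists 0; first exact: subspace0.
by exists b; rewrite ?add0r.
Qed.

End Subspaces.

Section MultivaluedProjections.
Context (K : fieldType) (X : lmodType K).
Implicit Types (M N E F S : set X) (P Q : set (X * X)).

(** The multivalued projection with range M and kernel N. *)
Definition mproj M N : set (X * X) := [set xy | M xy.2 /\ N (xy.1 - xy.2)].

Lemma mproj_multivalued_projection M N :
  subspace M -> subspace N -> multivalued_projection (mproj M N).
Proof.
move=> sM sN; split.
- apply/subspaceP; split; first by split; [|rewrite subr0]; apply: subspace0.
  move=> k [x y] [x' y'] [/= My Nxy] [/= My' Nxy']; split; first exact: subspaceZD.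
  by rewrite /= opprD addrACA -scalerBr; apply: subspaceZD.
- apply/seteqP; split=> [[x z] [y [/= My Nxy] [/= Mz Nyz]]|[x y] [/= My Nxy]].
    by split=> //=; rewrite -(subrKA y); apply: subspaceD.
  by exists y; split=> //=; rewrite subrr; apply: subspace0.
- move=> y [x [/= My _]]; exists y; split=> //=.
  by rewrite subrr; apply: subspace0.
Qed.

Lemma ker_mproj M N : subspace M -> ker (mproj M N) = N.
Proof.
move=> sM; apply/seteqP; split=> x; first by case=> _; rewrite subr0.
by move=> Nx; split; rewrite /= ?subr0 //; apply: subspace0.
Qed.

Lemma mul_mproj M N : subspace N -> Defs.mul (mproj M N) = M `&` N.
Proof.
move=> sN; apply/seteqP; split=> y [My Ny]; split=> //=.
  by rewrite -[y]opprK -(sub0r y); exact: (subspaceN sN Ny).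
by rewrite sub0r; apply: subspaceN.
Qed.

Lemma mproj_projection M N : subspace M -> subspace N ->
  M `&` N = [set 0] -> projection (mproj M N).
Proof.
move=> sM sN MN0; split; last by rewrite mul_mproj.
exact: mproj_multivalued_projection.
Qed.

Lemma subspace_ran P : subspace P -> subspace P.`2.
Proof.
move=> sP; apply/subspaceP; split; first by exists 0; exact: (subspace0 sP).
by move=> k y y' [x Pxy] [x' Pxy']; exists (k *: x + x');
  exact: (subspaceZD k sP Pxy Pxy').
Qed.

Lemma subspace_ker P : subspace P -> subspace (ker P).
Proof.
move=> sP; apply/subspaceP; split; first exact: (subspace0 sP).
move=> k x x' Px Px'; have := subspaceZD k sP Px Px'.
by rewrite [X in P X](_ : _ = (k *: x + x', 0)) //; congr pair; rewrite /= scaler0 addr0.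
Qed.

(** The point is that P contains (y, y) for every y in its range: if P contains
    (x, y), and (y, z) since ran P `<=` dom P, then it contains (x, z) by
    idempotence, hence (0, z - y), hence (y, z) - (0, z - y). *)
Lemma multivalued_projectionE P :
  multivalued_projection P -> P = mproj P.`2 (ker P).
Proof.
move=> [sP PP ranP]; have diagP x y : P (x, y) -> P (y, y).
  move=> Pxy; have [z Pyz] : P.`1 y by apply: ranP; exists x.
  have Pxz : P (x, z) by rewrite -PP; exists y.
  have := subspaceB sP Pyz (subspaceB sP Pxz Pxy).
  by congr P; congr pair => /=; rewrite ?subrr ?subr0 // opprB addrC subrK.
apply/seteqP; split=> [[x y] Pxy|[x y] [/= [x' Px'y] kerPxy]].
  split; first by exists x.
  have := subspaceB sP Pxy (diagP _ _ Pxy).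
  by congr P; congr pair; rewrite /= subrr.
have := subspaceD sP kerPxy (diagP _ _ Px'y).
by congr P; congr pair; rewrite /= ?subrK ?add0r.
Qed.

(** If e witnesses that (x, y) is in the left-hand side and e - y = n + w, then
    e - w is a witness for the right-hand side: it is still in E, and its
    distance to x changes by an element of F. *)
Lemma mproj_comp_enlarge M N E F : subspace E -> subspace F -> subspace N ->
  (mproj M [set n + w | n in N & w in E `&` F] \; mproj E F)%relation =
  (mproj M N \; mproj E F)%relation.
Proof.
move=> sE sF sN; apply/seteqP; split=> -[x y] [e [/= Ee Fxe] [/= My]].
  move=> [n Nn [w [Ew Fw] nwE]]; exists (e - w); split=> //=.
  - exact: subspaceB.
  - by rewrite opprB addrCA addrC; apply: subspaceD.
  - by rewrite addrAC -nwE addrK.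
move=> Ney; exists e => //; split=> //=; exists (e - y) => //.
by exists 0; [split; apply: subspace0 | rewrite addr0].
Qed.

(** Subtracting from the intermediate point its component in E `&` F changes
    neither x - e modulo F nor e - y modulo N. *)
Lemma mproj_comp_shrink M N E E' F : subspace E -> subspace F -> subspace N ->
  E `&` F `<=` N -> is_direct_sum E (E `&` F) E' ->
  (mproj M N \; mproj E F)%relation = (mproj M N \; mproj E' F)%relation.
Proof.
move=> sE sF sN EFN /[dup] dsE [_ EE'].
apply/seteqP; split=> -[x y] [e [/= Ee Fxe] [/= My Ney]].
  move: Ee; rewrite EE' => -[w EFw [e' E'e' weE]]; have Nw := EFN _ EFw.
  have e'E : e' = e - w by rewrite -weE addrC addKr.
  exists e'; split=> //=; rewrite e'E.
    by rewrite opprB addrCA addrC; apply: subspaceD => //; case: EFw.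
  by rewrite addrAC; apply: subspaceB.
by exists e; split=> //=; apply: (direct_sum_subr (subspaceI sE sF) dsE).
Qed.

(** This is the bridge between the two descriptions: it trades a multivalued
    part S inside the kernel of the left factor for a summand of its range. *)
Lemma mproj_comp_addl M N E F S : subspace S -> subspace N -> S `<=` N ->
  (mproj [set s + m | s in S & m in M] N \; mproj E F)%relation =
  [set a + b | a in (mproj M N \; mproj E F)%relation & b in [set 0] `*` S].
Proof.
move=> sS sN SN; apply/seteqP; split=> [[x y]|].
  move=> [e [/= Ee Fxe] [/= [s Ss [m Mm <-]] Ne]].
  exists (x, m); last first.
    by exists (0, s) => //; congr pair; rewrite /= ?addr0 // addrC.
  exists e; split=> //=.
  have -> : e - m = e - (s + m) + s by rewrite opprD addrA addrAC subrK.
  by apply: subspaceD => //; apply: SN.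
move=> _ [[x m] [e [/= Ee Fxe] [/= Mm Ne]] [[_ s] [/= -> Ss] <-]].
exists e; first by split; rewrite /= ?addr0.
split=> /=; first by exists s => //; exists m => //; rewrite addrC.
by rewrite opprD addrA; apply: subspaceB => //; apply: SN.
Qed.

Lemma mul_comp_projection P Q :
  projection P -> projection Q -> Defs.mul (P \; Q)%relation `<=` [set 0].
Proof.
move=> [_ mulP] [_ mulQ] z [y Qy Pyz].
have y0 : [set 0] y by rewrite -mulQ.
by rewrite -mulP /Defs.mul /= -[X in P (X, _)]y0.
Qed.

(** Removing from the range W of a multivalued projection the part that it
    shares with the kernel, by passing to a complement M, makes it
    single-valued. *)
Lemma mproj_projection_direct_sum W M N :
  subspace M -> subspace N -> subspace W -> is_direct_sum W (W `&` N) M ->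
  projection (mproj M N).
Proof.
move=> sM sN sW /[dup] dsW [WNM0 _]; apply: mproj_projection => //.
have MW := direct_sum_subr (subspaceI sW sN) dsW.
by rewrite -WNM0 setIC setIAC (setIidr MW) setIC.
Qed.

Lemma Mp2E :
  Mp2 X =
  [set T : set (X * X) | exists (P0 Q0 : set (X * X)) (S : set X),
     [/\ projection P0, projection Q0, subspace S, S `<=` ker P0
       & is_direct_sum T (P0 \; Q0)%relation ([set 0] `*` S)]].
Proof.
apply/seteqP; split=> T; last first.
  move=> [P [Q [S [prP [mpQ _] sS SP [_ ->]]]]].
  have [[sP _ _] [sQ _ _]] := (prP.1, mpQ).
  have [sM sN] := (subspace_ran sP, subspace_ker sP).
  exists (mproj [set s + m | s in S & m in P.`2] (ker P)).
    by apply: mproj_multivalued_projection => //; apply: subspace_sum.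
  exists Q => //; rewrite (multivalued_projectionE mpQ) mproj_comp_addl //.
  by rewrite -(multivalued_projectionE prP.1).
move=> [P mpP [Q mpQ <-]].
have [[sP _ _] [sQ _ _]] := (mpP, mpQ).
rewrite (multivalued_projectionE mpP) (multivalued_projectionE mpQ).
have [sM sN0] := (subspace_ran sP, subspace_ker sP).
have [sE sF] := (subspace_ran sQ, subspace_ker sQ).
move: P.`2 (ker P) Q.`2 (ker Q) sM sN0 sE sF => M N0 E F sM sN0 sE sF.
have sEF := subspaceI sE sF.
(* The kernel of the left factor must absorb E `&` F before E is shrunk. *)
rewrite -mproj_comp_enlarge //.
set N := [set n + w | n in N0 & w in E `&` F].
have sN : subspace N by exact: subspace_sum.
have EFN : E `&` F `<=` N.
  by move=> w EFw; exists 0; [exact: subspace0 | exists w; rewrite ?add0r].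
have sS := subspaceI sM sN.
have [E' [sE' dsE]] := subspace_complement sEF sE (@subIsetl _ _ _).
have [M' [sM' dsM]] := subspace_complement sS sM (@subIsetl _ _ _).
have prP0 := mproj_projection_direct_sum sM' sN sM dsM.
have prQ0 := mproj_projection_direct_sum sE' sF sE dsE.
exists (mproj M' N), (mproj E' F), (M `&` N); split=> //.
  by rewrite ker_mproj.
rewrite (mproj_comp_shrink _ sE sF sN EFN dsE); split; last first.
  by rewrite [in LHS]dsM.2 mproj_comp_addl.
apply/seteqP; split=> [[x y] /= [PQxy [/= x0 _]]|_ ->].
  by rewrite x0 in PQxy *; rewrite (mul_comp_projection prP0 prQ0 PQxy).
split; last by split=> //; apply: subspace0.
by exists 0; split; rewrite /= ?subrr; apply: subspace0.
Qed.

End MultivaluedProjections.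

Theorem corollary6p4 (R : realType) (k : RorC) (X : lmodType (scalars R k)) :
  Mp2 X =
  [set T : set (X * X) | exists (P0 Q0 : set (X * X)) (S : set X),
     [/\ projection P0, projection Q0, subspace S, S `<=` ker P0
       & is_direct_sum T (P0 \; Q0)%relation ([set 0] `*` S)]].
Proof. exact: Mp2E. Qed.
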